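(* Let $G=(V,E)$ be a finite simple connected undirected graph with $V=\{1,2,\dots,n\}$, let $d$ be its distance function and, for $v\in V$, let $\mathcal{N}(v)$ be the set of vertices adjacent to $v$. Let $X\subseteq V$ and let $x=(x_1,\dots,x_n)$ be defined by $x_i=1$ if $i\in X$ and $x_i=0$ if $i\notin X$. Then $X$ is a minimal convex dominating set of $G$ (that is, a convex dominating set of smallest cardinality) if and only if $x$ is an optimal solution of the following integer linear program: minimize $\sum_{i=1}^n x_i$ subject to - $x_i+\sum_{j\in\mathcal{N}(i)}x_j\ge 1$ for all $1\le i\le n$; - $x_k-x_i-x_j\ge -1$ for all $1\le i<j\le n$ and all $k\in V$ such that $d(i,k)+d(k,j)=d(i,j)$; - $x_i\in\{0,1\}$ for all $1\le i\le n$.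
   Context: Graphs are without loops and parallel edges. For vertices $u,v$ of a connected graph $G$, $d(u,v)$ denotes the length (number of edges) of a shortest $u$-$v$ path in $G$. $\mathcal{N}(v)$ is the open neighbourhood of $v$ (the set of all vertices adjacent to $v$, not containing $v$). A set $D\subseteq V$ is a dominating set of $G$ if every vertex $u\in V$ is in $D$ or has a neighbour in $D$. A set $X\subseteq V$ is convex if for every two vertices $u,v\in X$, all vertices of every shortest $u$-$v$ path in $G$ belong to $X$. A convex dominating set is a set that is both convex and dominating. A minimal convex dominating set is a convex dominating set of smallest cardinality among all convex dominating sets of $G$. *)

(* Defs.v *)
From mathcomp Require Import all_boot all_order all_algebra.

Set Implicit Arguments.
Unset Strict Implicit.
Unset Printing Implicit Defensive.

Import Order.TTheory GRing.Theory Num.Theory.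

(* A simple graph is a symmetric, irreflexive adjacency
   relation [e] on the finite type of its vertices. *)

Section Graph.
Variables (T : finType) (e : rel T).

Definition simple_graph : Prop := symmetric e /\ irreflexive e.

Definition connected_graph : Prop := forall u v : T, connect e u v.

Definition nbh (v : T) : {set T} := [set w | e v w].

(* The path is [u :: p], so its number of edges is [size p]. *)
Definition upath (u v : T) (p : seq T) : bool :=
  [&& path e u p, last u p == v & uniq (u :: p)].

Definition shortest_path (u v : T) (p : seq T) : Prop :=
  upath u v p /\ forall q : seq T, upath u v q -> size p <= size q.

(* The least length of a [u]-[v] path; a path has fewer than [#|T|] edges, and
   the value [#|T|] is taken only when there is no [u]-[v] path. *)
Definition dist (u v : T) : nat :=
  \big[minn/#|T|]_(k < #|T| | [exists p : k.-tuple T, upath u v p]) k.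

Definition dominating (D : {set T}) : Prop :=
  forall u : T, u \in D \/ exists2 w, w \in nbh u & w \in D.

Definition convex (X : {set T}) : Prop :=
  forall u v : T, u \in X -> v \in X ->
  forall p : seq T, shortest_path u v p -> {subset u :: p <= X}.

Definition convex_dominating (X : {set T}) : Prop := convex X /\ dominating X.

(* Minimality is in cardinality, not in inclusion. *)
Definition minimal_convex_dominating (X : {set T}) : Prop :=
  convex_dominating X /\
  forall Y : {set T}, convex_dominating Y -> #|X| <= #|Y|.

Lemma upath_size u v p : upath u v p -> size p < #|T|.
Proof. by case/and3P=> _ _ /card_uniqP /= <-; exact: max_card. Qed.

Lemma dist_le u v p : upath u v p -> dist u v <= size p.
Proof.
move=> up; rewrite /dist; have lt := upath_size up.
have ex : [exists q : (Ordinal lt).-tuple T, upath u v q].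
  by apply/existsP; exists (in_tuple p).
rewrite -minEnat -leEnat.
exact: (bigmin_le_cond _ (fun k : 'I_#|T| => (k : nat)) ex).
Qed.

Lemma shortest_path_dist u v p : shortest_path u v p -> dist u v = size p.
Proof.
case=> up minp; apply/eqP; rewrite eqn_leq dist_le //= /dist.
elim/big_rec: _ => [|k m /existsP[q uq] le_m].
  exact: ltnW (upath_size up).
by rewrite leq_min le_m andbT -(size_tuple q) minp.
Qed.

Lemma connect_shortest_path u v :
  connect e u v -> exists p, shortest_path u v p.
Proof.
case/connectP=> p0 /shortenP[p ep up _] ->.
have: exists k, [exists q : k.-tuple T, upath u (last u p) q].
  by exists (size p); apply/existsP; exists (in_tuple p); apply/and3P.
case/ex_minnP=> k /existsP[q uq] mink; exists q; split=> // r ur.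
by rewrite size_tuple mink //; apply/existsP; exists (in_tuple r).
Qed.

End Graph.

Section ILP.
Local Open Scope ring_scope.
Variables (n : nat) (e : rel 'I_n).

(* The vertices 1, ..., n are the elements 0, ..., n - 1 of ['I_n]. *)
Definition indicator (X : {set 'I_n}) : 'rV[int]_n :=
  \row_i (if i \in X then 1 else 0).

Definition objective (x : 'rV[int]_n) : int := \sum_i x 0 i.

Definition feasible (x : 'rV[int]_n) : Prop :=
  [/\ forall i : 'I_n, x 0 i + \sum_(j in nbh e i) x 0 j >= 1,
      forall i j k : 'I_n, (i < j)%N ->
        (dist e i k + dist e k j = dist e i j)%N ->
        x 0 k - x 0 i - x 0 j >= -1
    & forall i : 'I_n, x 0 i = 0 \/ x 0 i = 1].

Definition optimal (x : 'rV[int]_n) : Prop :=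
  feasible x /\
  forall y : 'rV[int]_n, feasible y -> objective x <= objective y.

End ILP.

(* Main.v *)
Require Import Defs.
From mathcomp Require Import all_boot all_order all_algebra.

Set Implicit Arguments.
Unset Strict Implicit.
Unset Printing Implicit Defensive.

Import Order.TTheory GRing.Theory Num.Theory.

(** A set X is convex if and only if it contains every vertex k with
    d(i,k) + d(k,j) = d(i,j) for some i, j in X: such k are exactly the vertices
    on the shortest i-j paths, because concatenating shortest i-k and k-j paths
    gives a walk of length d(i,j), which cannot repeat a vertex.  Read on 0-1
    vectors, this and domination are the constraints of the program, and the
    objective counts the ones. *)

Section Distance.
Variables (T : finType) (e : rel T).

(** Cutting the cycles out of a walk leaves a path on some of its vertices, so [dist] bounds walks
    with repetitions too. *)
Lemma walk_dist_le u p : path e u p -> dist e u (last u p) <= size p.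
Proof.
move=> ep; case: (shortenP ep) => p' ep' uniq_p' sub_p'.
apply: (@leq_trans (size p')); first by apply: dist_le; apply/and3P.
by apply: uniq_leq_size sub_p'; case/andP: uniq_p'.
Qed.

Lemma walk_shortest_path u p :
  path e u p -> size p <= dist e u (last u p) -> shortest_path e u (last u p) p.
Proof.
move=> ep le_p; split=> [|q uq]; last exact: leq_trans le_p (dist_le uq).
rewrite /upath ep eqxx !andTb; case: (shortenP ep) le_p => p' ep' uniq_p' sub_p' le_p.
(* The loop-free [u :: p'] lies inside [u :: p] and is at least as long, which leaves no room for a
   repetition in [u :: p]. *)
apply: (@leq_size_uniq _ (u :: p')) => // [x|].
  by rewrite !inE; case: eqP => //= _; exact: sub_p'.
by rewrite ltnS; apply: leq_trans le_p _; apply: dist_le; apply/and3P.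
Qed.

Lemma distxx u : dist e u u = 0.
Proof. by apply/eqP; rewrite -leqn0 (@walk_dist_le u [::]). Qed.

Hypothesis e_connected : connected_graph e.

Lemma dist_walk u v :
  exists p, [/\ path e u p, last u p = v & size p = dist e u v].
Proof.
have [p sp] := connect_shortest_path (e_connected u v).
exists p; rewrite (shortest_path_dist sp).
by case: sp => /and3P[-> /eqP-> _] _.
Qed.

Lemma dist_eq0 u v : dist e u v = 0 -> u = v.
Proof. by have [p [_ <- <-]] := dist_walk u v; move/size0nil->. Qed.

Lemma dist_triangle k u v : dist e u v <= dist e u k + dist e k v.
Proof.
have [p [ep <- <-]] := dist_walk u k; have [q [e_q <- <-]] := dist_walk (last u p) v.
by rewrite -size_cat -last_cat walk_dist_le // cat_path ep.
Qed.

Lemma dist_sym : symmetric e -> forall u v, dist e u v = dist e v u.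
Proof.
move=> e_sym.
suff le u v : dist e u v <= dist e v u by move=> u v; apply/eqP; rewrite eqn_leq !le.
have [p [ep <- <-]] := dist_walk v u; set w := last v p.
(* The walk traversed backwards starts at [w] and continues along [rev (belast v p)]. *)
have ->: v = last w (rev (belast v p)).
  by rewrite /w; case: p {ep w} => //= a p; rewrite rev_cons last_rcons.
rewrite -(size_belast v p) -size_rev walk_dist_le //.
by rewrite rev_path (eq_path (e' := e)) // => x y; exact: e_sym.
Qed.

Lemma convex_dist (X : {set T}) :
  convex e X <-> {in X &, forall i j k,
    dist e i k + dist e k j = dist e i j -> k \in X}.
Proof.
split=> [convX i j iX jX k | distX u v uX vX p sp k].
  have [p [ep pk <-]] := dist_walk i k; have [q [e_q qj <-]] := dist_walk k j.
  rewrite -size_cat => pq_dist.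
  have pq_last : last i (p ++ q) = j by rewrite last_cat pk.
  have sp : shortest_path e i j (p ++ q).
    by rewrite -pq_last; apply: walk_shortest_path;
      rewrite ?cat_path ?ep ?pk // pq_last pq_dist.
  apply: (convX _ _ iX jX _ sp).
  by rewrite -cat_cons mem_cat -pk mem_last.
move=> kp; apply: (distX u v) => //; apply/eqP; rewrite eqn_leq dist_triangle andbT.
rewrite (shortest_path_dist sp); case: sp => /and3P[+ + _] _.
(* Cutting the path at [k] bounds both distances by the lengths of the pieces; the triangle
   inequality gave the converse. *)
case/splitPl: kp => p1 p2 <-; rewrite cat_path last_cat size_cat.
by case/andP=> ep1 ep2 /eqP<-; rewrite leq_add ?walk_dist_le.
Qed.

End Distance.

Section Program.
Local Open Scope ring_scope.
Variable n : nat.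
Implicit Types (e : rel 'I_n) (X : {set 'I_n}).

Lemma indicatorE X i : indicator X 0 i = (i \in X)%:R.
Proof. by rewrite mxE; case: ifP. Qed.

Lemma objective_indicator X : objective (indicator X) = #|X|%:R.
Proof.
rewrite /objective (eq_bigr _ (fun i _ => indicatorE X i)) -natr_sum.
by rewrite -big_mkcond /= sum1_card.
Qed.

Lemma feasible_indicator e : symmetric e -> connected_graph e ->
  forall X, feasible e (indicator X) <-> convex_dominating e X.
Proof.
move=> e_sym e_conn X; split=> [[domX convX _] | [/(convex_dist e_conn) convX domX]].
  split=> [|u].
    (* The program only constrains pairs [i < j]. Symmetry of [dist] yields [j < i], and for [i = j]
       the distance sum is 0, forcing [k = i]. *)
    have lt_conv (i j k : 'I_n) : (i < j)%N -> i \in X -> j \in X ->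
        (dist e i k + dist e k j = dist e i j)%N -> k \in X.
      move=> lt_ij iX jX /(convX _ _ _ lt_ij).
      by rewrite !indicatorE iX jX; case: (k \in X).
    apply/(convex_dist e_conn) => i j iX jX k dist_k.
    have [lt_ij | lt_ji | /val_inj eq_ij] := ltngtP i j.
    - exact: lt_conv lt_ij _ _ dist_k.
    - apply: lt_conv lt_ji jX iX _.
      by rewrite addnC (dist_sym e_conn e_sym k) !(dist_sym e_conn e_sym j).
    - move: dist_k; rewrite -eq_ij distxx => /eqP; rewrite addn_eq0 => /andP[/eqP].
      by move/(dist_eq0 e_conn) <-.
  case: (boolP (u \in X)) => [|uX]; [by left | right].
  have := domX u; rewrite indicatorE (negPf uX) add0r.
  (* Without a neighbour in [X] the constraint at [u] would read 0 >= 1. *)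
  case: (pickP [pred w in nbh e u | w \in X]) => [w /andP[uw wX] _ | noX].
    by exists w.
  rewrite big1 // => w uw; rewrite indicatorE.
  by have := noX w; rewrite /= uw /= => ->.
split=> [i | i j k _ dist_k | i].
- have nbh_ge0 (P : pred 'I_n) : 0 <= \sum_(j | P j) indicator X 0 j.
    by apply: sumr_ge0 => j _; rewrite indicatorE ler0n.
  rewrite indicatorE; case: (domX i) => [-> | [w iw wX]].
    by rewrite lerDl nbh_ge0.
  rewrite (bigD1 w) //= indicatorE wX addrCA lerDl addr_ge0 ?ler0n //.
(* The left side drops below -1 only when [i] and [j] are in [X] and [k] is not. *)
- rewrite !indicatorE; have := convX i j; case: (i \in X); case: (j \in X);
    case kX: (k \in X) => //.
  by move=> /(_ isT isT k dist_k); rewrite kX.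
- by rewrite indicatorE; case: (i \in X); [right | left].
Qed.

(** By the 0-1 constraint, optimizing over feasible vectors amounts to optimizing over vertex
    sets. *)
Lemma feasible_eq_indicator e x :
  feasible e x -> x = indicator [set i | x 0 i == 1].
Proof.
case=> _ _ x01; apply/rowP=> i; rewrite indicatorE inE.
by case: (x01 i) => ->.
Qed.

End Program.

Theorem theorem2 (n : nat) (e : rel 'I_n)
    (e_simple : simple_graph e) (e_connected : connected_graph e)
    (X : {set 'I_n}) :
  minimal_convex_dominating e X <-> optimal e (indicator X).
Proof.
case: e_simple => e_sym _; have feasE := feasible_indicator e_sym e_connected.
split=> -[/feasE cdX minX]; split=> // y fy.
  rewrite (feasible_eq_indicator fy) !objective_indicator ler_nat.
  by apply/minX/feasE; rewrite -(feasible_eq_indicator fy).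
by rewrite -(ler_nat int) -!objective_indicator; apply/minX/feasE.
Qed.
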